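(* Let $t,r\in\mathbb{R}$ with $t>0$ and $r\geq -\binom{\lfloor t+1\rfloor}{2}$, and put $s=\binom{\lfloor t\rfloor+1}{2}+r$. Then there is a constant $c(s,t)$, depending only on $s$ and $t$ (equivalently, only on $t$ and $r$), such that for every positive integer $n$ and every $n$-vertex graph $G$ with the property $P_{t,r}$, $$\rho(G)\leq c(s,t)+\sqrt{\lfloor t\rfloor n}.$$
   Context: All graphs are finite, simple and undirected. $\rho(G)$ denotes the spectral radius of the adjacency matrix of $G$. A graph $G$ has the (Hereditarily Bounded) property $P_{t,r}$ if every subgraph $H\subseteq G$ with $|V(H)|\geq t$ satisfies $|E(H)|\leq t\,|V(H)|+r$. *)

(* Defs.v *)
From HB Require Import structures.
From mathcomp Require Import all_boot all_order all_algebra.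
From mathcomp Require Import classical_sets reals.
From mathcomp Require Import complex.

Set Implicit Arguments.
Unset Strict Implicit.
Unset Printing Implicit Defensive.

Import Order.TTheory GRing.Theory Num.Theory.
Local Open Scope ring_scope.

Record sgraph (T : finType) := SGraph {
  adj :> rel T;
  adj_sym : symmetric adj;
  adj_irr : irreflexive adj }.

Definition edges (T : finType) (G : sgraph T) : {set {set T}} :=
  [set [set p.1; p.2] | p in [set p : T * T | adj G p.1 p.2]].

(* Subgraphs need not be induced: any set F of edges of G with both endpoints
   in S is allowed. *)
Definition is_subgraph (T : finType) (G : sgraph T)
    (S : {set T}) (F : {set {set T}}) : bool :=
  (F \subset edges G) && [forall e in F, e \subset S].

Definition hered_bounded (R : realType) (t r : R) (T : finType)
    (G : sgraph T) : Prop :=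
  forall (S : {set T}) (F : {set {set T}}), is_subgraph G S F ->
    t <= #|S|%:R -> #|F|%:R <= t * #|S|%:R + r.

Definition adjmx (R : realType) (T : finType) (G : sgraph T) : 'M[R]_#|T| :=
  \matrix_(i, j) (adj G (enum_val i) (enum_val j))%:R.

(* For n > 0 the set of moduli is finite and nonempty, so this supremum is the
   maximum modulus of a complex eigenvalue. *)
Definition spectral_radius (R : realType) (n : nat) (A : 'M[R]_n) : R :=
  sup [set x : R | exists z : R[i],
    eigenvalue (map_mx (real_complex R) A) z /\ x = Normc.normc z]%classic.

Definition graph_radius (R : realType) (T : finType) (G : sgraph T) : R :=
  spectral_radius (adjmx R G).

(* Num.truncn x is the floor of x, as a natural number, for x >= 0; it is only
   used at t and t + 1 with t > 0. *)
Definition s_param (R : realType) (t r : R) : R :=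
  'C((Num.truncn t).+1, 2)%:R + r.

(* Main.v *)
Require Import Defs.
From mathcomp Require Import all_boot all_order all_algebra.
From mathcomp Require Import reals complex.
From mathcomp Require Import ring lra.

Set Implicit Arguments.
Unset Strict Implicit.
Unset Printing Implicit Defensive.

Import Order.TTheory GRing.Theory Num.Theory.
Local Open Scope ring_scope.

(** Write k for the floor of t, A for the adjacency matrix and 1 for the all-one
    vector.  Everything follows from one pointwise inequality
      A^2 1 <= (k n + b) 1 + a A 1,      a, b depending only on t and r.
    The entry of A^2 1 at v counts the pairs (w, u) with u a common neighbour
    of v and w.  A vertex w with at most k neighbours in N(v) accounts for the
    term k n.  Let W be the set of the other vertices outside N(v), each with
    at least k + 1 neighbours in N(v).  The edges between W and N(v) number at
    least (k + 1) |W| and, by sparsity, at most t (|W| + deg v) + O(1); since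
    k + 1 > t, this forces |W| = O(deg v + 1), and then sparsity again bounds
    these edges, like those inside N(v), by O(deg v + 1) ([two_walks_le]).  So
    the excess over k n is linear in deg v, which is the entry of A 1 at v.

    If z is an eigenvalue of modulus l, the moduli of the entries of an
    eigenvector form a row vector y with l y <= y A entrywise.  Pairing y with
    the inequality above gives l^2 <= a l + k n + b ([walk_growth_bound]), hence
    l <= a + sqrt b + sqrt (k n). *)

Definition nbhd (T : finType) (G : sgraph T) (v : T) : {set T} :=
  [set u | adj G v u].

Definition arcs (T : finType) (G : sgraph T) (X Y : {set T}) : {set T * T} :=
  [set p | [&& p.1 \in X, p.2 \in Y & adj G p.1 p.2]].

Definition arc_edges (T : finType) (G : sgraph T) (X Y : {set T}) :
  {set {set T}} := [set [set p.1; p.2] | p in arcs G X Y].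

Lemma card_arcs (T : finType) (G : sgraph T) (X Y : {set T}) :
  #|arcs G X Y| = (\sum_(w in X) #|nbhd G w :&: Y|)%N.
Proof.
under eq_bigr do rewrite -sum1_card.
rewrite pair_big_dep /= -sum1_card; apply: eq_bigl => -[w u] /=.
by rewrite !inE /= [adj G w u && _]andbC.
Qed.

Lemma arc_edges_subgraph (T : finType) (G : sgraph T) (X Y : {set T}) :
  is_subgraph G (X :|: Y) (arc_edges G X Y).
Proof.
apply/andP; split.
  apply: imsetS; apply/subsetP => p; rewrite !inE; by case/and3P.
apply/forall_inP => e /imsetP[p]; rewrite !inE => /and3P[pX pY _] ->.
by apply/subsetP => z; rewrite !inE => /orP[] /eqP ->; rewrite ?pX ?pY ?orbT.
Qed.

Lemma set2_eq (T : finType) (a b c d : T) :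
  [set a; b] = [set c; d] -> (a, b) = (c, d) \/ (a, b) = (d, c).
Proof.
move=> E.
have ha : a \in [set c; d] by rewrite -E set21.
have hb : b \in [set c; d] by rewrite -E set22.
have hc : c \in [set a; b] by rewrite E set21.
have hd : d \in [set a; b] by rewrite E set22.
case/set2P: ha hc hd => ->; case/set2P: hb => -> hc hd; try by auto.
  by move: hd; rewrite !inE orbb => /eqP ->; left.
by move: hc; rewrite !inE orbb => /eqP ->; left.
Qed.

(** Disjointness fixes the orientation of each edge between X and Y, so no edge
    is counted twice.  Avoiding the factor 2 of [card_arcs_le] matters: the
    count is later compared with k + 1 > t. *)
Lemma card_arcs_disjoint (T : finType) (G : sgraph T) (X Y : {set T}) :
  [disjoint X & Y] -> #|arcs G X Y| = #|arc_edges G X Y|.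
Proof.
move=> dXY; rewrite /arc_edges card_in_imset // => -[a b] [c d].
rewrite !inE /= => /and3P[aX bY _] /and3P[cX dY _] /set2_eq[] // [_ bc].
by move: (disjointFr dXY cX); rewrite -bc bY.
Qed.

Lemma card_arcs_le (T : finType) (G : sgraph T) (X Y : {set T}) :
  (#|arcs G X Y| <= 2 * #|arc_edges G X Y|)%N.
Proof.
(* An arc is determined by its edge and one bit recording its direction. *)
pose f (p : T * T) := ([set p.1; p.2], (enum_rank p.1 < enum_rank p.2)%N).
have f_inj : {in arcs G X Y &, injective f}.
  move=> [a b] [c d]; rewrite !inE /= => /and3P[_ _ ab] _ [/set2_eq[] // [-> ->]].
  by case: ltngtP => // /val_inj /enum_rank_inj ->.
rewrite -(card_in_imset f_inj) mulnC -card_bool -cardsT -cardsX.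
apply/subset_leq_card/subsetP => _ /imsetP[p pA ->].
by rewrite !inE /= andbT; apply/imsetP; exists p.
Qed.

Lemma subgraph_card_le (T : finType) (G : sgraph T) S F :
  is_subgraph G S F -> (#|F| <= #|S| * #|S|)%N.
Proof.
case/andP=> /subsetP FE /forall_inP FS.
rewrite -cardsX; apply: leq_trans (leq_imset_card (fun p => [set p.1; p.2]) _).
apply/subset_leq_card/subsetP => e eF.
have /imsetP[p _ ep] := FE _ eF; apply/imsetP; exists p => //.
by have /subsetP eS := FS _ eF; rewrite !inE !eS ?ep ?set21 ?set22.
Qed.

(** Subgraphs with fewer than t vertices have at most t^2 edges, so enlarging
    the additive constant removes the restriction on the order. *)
Lemma hered_bounded_subgraph (R : realType) (t r : R) (T : finType)
    (G : sgraph T) S F :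
  0 < t -> hered_bounded t r G -> is_subgraph G S F ->
  #|F|%:R <= t * #|S|%:R + (`|r| + t ^+ 2).
Proof.
move=> t0 hG sF; have S0 : 0 <= #|S|%:R :> R by exact: ler0n.
have [tS|St] := lerP t #|S|%:R.
  apply: le_trans (hG _ _ sF tS) _; rewrite lerD2l.
  by apply: le_trans (ler_norm r) _; rewrite lerDl sqr_ge0.
apply: (@le_trans _ _ (#|S|%:R * #|S|%:R)).
  by rewrite -natrM ler_nat (subgraph_card_le sF).
have := normr_ge0 r; nra.
Qed.

(** Counts the walks of length 2 from v by their end w.  Ends with at most k
    neighbours in N(v) give the main term; outside N(v) the others are so few
    that their contribution is linear in the degree of v, with a constant that
    grows as the gap q = k + 1 - t closes.  Arcs within N(v) are counted in both
    directions, which is where 2 of the 3 in the coefficients come from. *)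
Lemma two_walks_le (R : realType) (t r : R) (T : finType) (G : sgraph T)
    (k : nat) (b := `|r| + t ^+ 2) (q := k.+1%:R - t) (v : T) :
  0 < t -> 0 < q -> hered_bounded t r G ->
  (\sum_(w : T) #|nbhd G w :&: nbhd G v|)%:R <=
    k%:R * #|T|%:R + (3 * t + t ^+ 2 / q) * #|nbhd G v|%:R
      + (3 * b + t * b / q).
Proof.
move=> t0 q0 hG; set N := nbhd G v.
pose W := [set w | (w \notin N) && (k < #|nbhd G w :&: N|)%N].
have dWN : [disjoint W & N].
  by rewrite disjoint_subset; apply/subsetP => w; rewrite !inE => /andP[].
have bd X Y : #|arc_edges G X Y|%:R <= t * #|X :|: Y|%:R + b.
  exact: hered_bounded_subgraph t0 hG (arc_edges_subgraph G X Y).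
have NN : #|arcs G N N|%:R <= 2 * (t * #|N|%:R + b).
  have := bd N N; rewrite setUid => h.
  apply: (@le_trans _ _ (2 * #|arc_edges G N N|)%N%:R).
    by rewrite ler_nat card_arcs_le.
  by rewrite natrM ler_wpM2l.
have WN : #|arcs G W N|%:R <= t * (#|W|%:R + #|N|%:R) + b.
  rewrite (card_arcs_disjoint _ dWN) -natrD.
  move: dWN; rewrite -leq_card_setU => /eqP <-; exact: bd.
have Wk : k.+1%:R * #|W|%:R <= #|arcs G W N|%:R :> R.
  rewrite -natrM ler_nat card_arcs mulnC -sum_nat_const.
  by apply: leq_sum => w; rewrite !inE => /andP[].
have Wq : #|W|%:R <= (t * #|N|%:R + b) / q.
  rewrite ler_pdivlMr // /q; lra.
(* Ends outside N(v) split according to membership in W; the ends inside N(v)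
   are all charged to the arcs within N(v). *)
have split_sum : (\sum_(w : T) #|nbhd G w :&: N| <=
    k * #|T| + #|arcs G W N| + #|arcs G N N|)%N.
  rewrite !card_arcs (bigID (mem N)) /= addnC leq_add2r.
  rewrite (bigID (fun w => k < #|nbhd G w :&: N|)%N) /= addnC; apply: leq_add.
    apply: (@leq_trans (\sum_(w in T) k)).
      rewrite [leqRHS](bigID (fun w => (w \notin N) && ~~ (k < #|nbhd G w :&: N|)%N)) /=.
      apply: leq_trans (leq_addr _ _); apply: leq_sum => w /andP[_].
      by rewrite -leqNgt.
    by rewrite sum_nat_const mulnC.
  by rewrite (eq_bigl (mem W)) // => w; rewrite !inE.
move: split_sum; rewrite -(ler_nat R) !natrD natrM => h.
apply: le_trans h _; rewrite -[leRHS]addrA.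
have -> : (3 * t + t ^+ 2 / q) * #|N|%:R + (3 * b + t * b / q) =
   t * ((t * #|N|%:R + b) / q) + 3 * (t * #|N|%:R + b).
  by field; rewrite gt_eqF.
nra.
Qed.

(** With Y the total weight of y and D that of y A, the hypotheses give
    l Y <= D and l D <= m Y + a D.  If l > a, the second reads (l - a) D <= m Y,
    and the first turns this into (l - a) l <= m.  The
    inequality l y <= y A is used only against the nonnegative vectors 1 and
    A 1, so a subinvariant y does the work of a Perron eigenvector. *)
Lemma walk_growth_bound (R : realType) (T : finType) (A : T -> T -> R)
    (y : T -> R) (l a m : R) :
  (forall i j, 0 <= A i j) -> (forall i, 0 <= y i) -> 0 < \sum_i y i ->
  0 <= l -> 0 <= m ->
  (forall j, l * y j <= \sum_i y i * A i j) ->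
  (forall i, \sum_j A i j * \sum_h A j h <= m + a * \sum_j A i j) ->
  l ^+ 2 <= a * l + m.
Proof.
move=> A0 y0 Y0 l0 m0 ly walk.
pose d i := \sum_j A i j; pose Y := \sum_i y i; pose D := \sum_i y i * d i.
have d0 i : 0 <= d i by exact: sumr_ge0.
have lY (z : T -> R) : (forall i, 0 <= z i) ->
    l * \sum_j y j * z j <= \sum_i y i * \sum_j A i j * z j.
  move=> z0; under [leRHS]eq_bigr do rewrite mulr_sumr.
  rewrite exchange_big mulr_sumr /=; apply: ler_sum => j _.
  rewrite mulrA; under eq_bigr do rewrite mulrA.
  by rewrite -mulr_suml ler_wpM2r.
have lYD : l * Y <= D.
  have := lY (fun=> 1) (fun=> ler01).
  rewrite /Y /D /d; under eq_bigr do rewrite mulr1.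
  by under [leRHS]eq_bigr do under eq_bigr do rewrite mulr1.
have lD : l * D <= m * Y + a * D.
  apply: le_trans (lY d d0) _.
  rewrite /Y /D !mulr_sumr -big_split; apply: ler_sum => i _ /=.
  by rewrite [m * _]mulrC mulrCA -mulrDr ler_wpM2l // walk.
have [la|la] := lerP l a.
  by rewrite expr2 -[leLHS]addr0 lerD // ler_wpM2r.
have h : (l - a) * (l * Y) <= (l - a) * D by rewrite ler_wpM2l // subr_ge0 ltW.
rewrite -(ler_pM2r Y0) -/Y; lra.
Qed.

(** Take the moduli of the entries of an eigenvector: the triangle inequality
    turns the eigenvalue equation into an inequality between nonnegative reals. *)
Lemma eigenvalue_subinvariant (R : realType) n (A : 'M[R]_n) (z : R[i]) :
  (forall i j, 0 <= A i j) ->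
  eigenvalue (map_mx (real_complex R) A) z ->
  exists y : 'I_n -> R, [/\ forall i, 0 <= y i, 0 < \sum_i y i &
    forall j, Normc.normc z * y j <= \sum_i y i * A i j].
Proof.
move=> A0 /eigenvalueP[x xA x0]; exists (fun i => Normc.normc (x 0 i)).
have nn (u : R[i]) : 0 <= Normc.normc u by case: u => u1 u2; rewrite sqrtr_ge0.
split=> // [|j].
  have [i xi] : exists i, x 0 i != 0 by apply/rV0Pn.
  rewrite (bigD1 i) //= ltr_pwDl ?sumr_ge0 //.
  by rewrite lt_def nn andbT; apply: contra xi => /eqP /Normc.eq0_normc ->.
have := congr1 (fun v : 'rV_n => v 0 j) xA; rewrite /= !mxE => e.
rewrite -Normc.normcM -e.
elim/big_rec2: _ => [|i u1 u2 _ IH]; first by rewrite Normc.normc0.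
apply: le_trans (le_normcD _ _) _; rewrite lerD // !mxE Normc.normcM.
by rewrite /= expr0n /= addr0 sqrtr_sqr ger0_norm.
Qed.

Lemma le_sqrt_of_quadratic (R : realType) (l a m b : R) :
  0 <= a -> 0 <= m -> 0 <= b -> l ^+ 2 <= a * l + (m + b) ->
  l <= a + Num.sqrt b + Num.sqrt m.
Proof.
move=> a0 m0 b0 q; rewrite leNgt; apply/negP => lt.
move: q lt (sqrtr_ge0 b) (sqrtr_ge0 m).
rewrite -{1}(sqr_sqrtr m0) -{1}(sqr_sqrtr b0).
move: (Num.sqrt m) (Num.sqrt b) => x y q lt y0 x0.
(* Otherwise both l and l - a exceed x + y, whose square is at least
   x^2 + y^2. *)
have : (x + y) * (x + y) < l * (l - a) by nra.
nra.
Qed.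

Lemma graph_radius_le (R : realType) (T : finType) (G : sgraph T) (a m b : R) :
  0 <= a -> 0 <= m -> 0 <= b ->
  (forall v : T, (\sum_(w : T) #|nbhd G w :&: nbhd G v|)%:R <=
    m + a * #|nbhd G v|%:R + b) ->
  graph_radius R G <= a + Num.sqrt b + Num.sqrt m.
Proof.
move=> a0 m0 b0 walks; rewrite /graph_radius /spectral_radius.
set E := (X in sup X).
(* The empty set has supremum 0, which satisfies the bound. *)
have [E0|/classical_sets.nonemptyPn ->] :=
  boolp.pselect (classical_sets.nonempty E); last first.
  by rewrite sup0 !addr_ge0 // sqrtr_ge0.
apply: ge_sup => //= _ [z [zA ->]].
apply: le_sqrt_of_quadratic => //.
have A0 i j : 0 <= adjmx R G i j by rewrite mxE.
have [y [y0 Y0 yz]] := eigenvalue_subinvariant A0 zA.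
apply: (@walk_growth_bound _ _ (adjmx R G) y) => //.
- by case: (z) => u1 u2; rewrite sqrtr_ge0.
- exact: addr_ge0.
have reT (F : T -> R) : \sum_(j < #|T|) F (enum_val j) = \sum_(u : T) F u.
  rewrite (reindex (@enum_val T T)) //=.
  by exists enum_rank => ? _; rewrite ?enum_valK ?enum_rankK.
have deg i : \sum_j adjmx R G i j = #|nbhd G (enum_val i)|%:R.
  under eq_bigr do rewrite mxE.
  rewrite (reT (fun u => (adj G _ u)%:R)) -sum1_card natr_sum [RHS]big_mkcond.
  by apply: eq_bigr => u _; rewrite inE; case: (adj G _ u).
move=> i; rewrite deg addrAC; set v := enum_val i.
apply: le_trans (walks v); rewrite le_eqVlt; apply/orP; left; apply/eqP.
under [LHS]eq_bigr do rewrite deg mxE.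
rewrite (reT (fun u => (adj G v u)%:R * #|nbhd G u|%:R)) natr_sum.
under [LHS]eq_bigr => u _ do rewrite -sum1_card natr_sum mulr_sumr big_mkcond.
(* Walks v - u - w are now grouped by their end w instead of their middle u. *)
rewrite exchange_big /=; apply: eq_bigr => w _.
rewrite -sum1_card natr_sum [RHS]big_mkcond; apply: eq_bigr => u _ /=.
by rewrite !inE (adj_sym G u w); do 2![case: (adj G _ _)]; rewrite ?mulr1 ?mulr0.
Qed.

Theorem theorem1p2 (R : realType) :
  exists c : R -> R -> R,
    forall t r : R, 0 < t -> - 'C(Num.truncn (t + 1), 2)%:R <= r ->
    forall n : nat, (0 < n)%N ->
    forall (T : finType) (G : sgraph T), #|T| = n ->
      hered_bounded t r G ->
      graph_radius R G <= c (s_param t r) t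
                          + Num.sqrt ((Num.truncn t)%:R * n%:R).
Proof.
pose a (t : R) : R := 3 * t + t ^+ 2 / ((Num.truncn t).+1%:R - t).
pose e (t r : R) : R := `|r| + t ^+ 2.
pose b (t r : R) : R := 3 * e t r + t * e t r / ((Num.truncn t).+1%:R - t).
(* r is recovered from s and t by inverting the definition of s. *)
exists (fun s t => a t + Num.sqrt (b t (s - 'C((Num.truncn t).+1, 2)%:R))).
move=> t r t0 _ n _ T G <- hG.
have q0 : 0 < (Num.truncn t).+1%:R - t by rewrite subr_gt0 truncnS_gt.
have e0 : 0 <= e t r by rewrite addr_ge0 // sqr_ge0.
have [t0' q0'] := (ltW t0, ltW q0).
rewrite /s_param [X in b t X]addrC addKr; apply: graph_radius_le.
- by apply: addr_ge0; [exact: mulr_ge0 | rewrite divr_ge0 // sqr_ge0].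
- exact: mulr_ge0.
- by apply: addr_ge0; [exact: mulr_ge0 | rewrite divr_ge0 // mulr_ge0].
- by move=> v; apply: two_walks_le.
Qed.
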